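(* There exist an absolute constant $c_1>0$ and, for every $0<\alpha<1$, $\delta>0$, $r>0$ and every value of the ratio $L/\gamma$, a constant $c_0=c_0(\alpha,\delta,r,L/\gamma)$ depending only on these quantities, such that the following holds. Let $X$ be a symmetric random vector in $\mathbb{R}^n$, let $\|\cdot\|$ be a norm on $\mathbb{R}^n$ and let $\gamma,\delta,r,L>0$ be such that for every $t\in\mathbb{R}^n$, $$\mathbb{P}\big(|\langle X,t\rangle|\ge \gamma\|t\|\big)\ge\delta \qquad\text{and}\qquad \big(\mathbb{E}|\langle X,t\rangle|^r\big)^{1/r}\le L\|t\|.$$ Let $0<\alpha<1$, let $N\ge c_0 n$, set $p=\alpha\log(eN/n)$, and let $X_1,\dots,X_N$ be independent copies of $X$. Then with probability at least $1-2\exp(-c_1N^{1-\alpha}n^\alpha)$, $$\mathrm{absconv}(X_1,\dots,X_N)\supset \tfrac12\,\big(K_p(X)\big)^\circ .$$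
   Context: A random vector $X$ is symmetric if $X$ and $-X$ have the same distribution. $\mathrm{absconv}(X_1,\dots,X_N)$ is the convex hull of $\pm X_1,\dots,\pm X_N$. For a symmetric random vector $X$ in $\mathbb{R}^n$ and $p\ge1$, the floating body is $K_p(X)=\{t\in\mathbb{R}^n:\mathbb{P}(\langle X,t\rangle\ge1)\le\exp(-p)\}$. For $T\subset\mathbb{R}^n$ the polar is $T^\circ=\{x\in\mathbb{R}^n:\langle t,x\rangle\le1\text{ for every }t\in T\}$. $\log$ is the natural logarithm. *)

(* Defs.v *)
From HB Require Import structures.
From mathcomp Require Import all_boot all_order all_algebra.
From mathcomp Require Import all_classical all_reals all_analysis.

Set Implicit Arguments.
Unset Strict Implicit.
Unset Printing Implicit Defensive.

Import Order.TTheory GRing.Theory Num.Theory.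
Import numFieldNormedType.Exports.

Local Open Scope classical_set_scope.
Local Open Scope ring_scope.

Section EuclideanSpace.
Context {R : realType} {n : nat}.
Implicit Types (x y t : 'rV[R]_n) (A : set 'rV[R]_n).

Definition dotp x t : R := \sum_(i < n) x 0 i * t 0 i.

(* An arbitrary norm on R^n, as opposed to the sup norm `|x| that the library
   attaches to 'rV[R]_n. *)
Record is_norm (nrm : 'rV[R]_n -> R) : Prop := IsNorm {
  norm_ge0 : forall x, 0 <= nrm x ;
  norm_eq0 : forall x, nrm x = 0 -> x = 0 ;
  norm_scale : forall (a : R) x, nrm (a *: x) = `|a| * nrm x ;
  norm_triangle : forall x y, nrm (x + y) <= nrm x + nrm y }.

Definition conv_hull A : set 'rV[R]_n :=
  [set x | exists m (a : 'I_m -> R) (v : 'I_m -> 'rV[R]_n),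
    [/\ forall i, 0 <= a i, \sum_(i < m) a i = 1, forall i, A (v i)
      & x = \sum_(i < m) a i *: v i]].

Definition absconv N (v : 'I_N -> 'rV[R]_n) : set 'rV[R]_n :=
  conv_hull (range v `|` range (fun i => - v i)).

Definition polar A : set 'rV[R]_n :=
  [set x | forall t, A t -> dotp t x <= 1].

Definition borel : set (set 'rV[R]_n) := <<s @open 'rV[R]_n >>.

End EuclideanSpace.

Definition random_vector {R : realType} {n : nat} {d : measure_display}
    {T : measurableType d} (X : T -> 'rV[R]_n) : Prop :=
  forall B, borel B -> measurable (X @^-1` B).

Definition same_distribution {R : realType} {n : nat}
    {d d' : measure_display} {T : measurableType d} {T' : measurableType d'}
    (P : probability T R) (P' : probability T' R)
    (X : T -> 'rV[R]_n) (Y : T' -> 'rV[R]_n) : Prop :=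
  forall B, borel B -> P (X @^-1` B) = P' (Y @^-1` B).

Definition symmetric_vector {R : realType} {n : nat} {d : measure_display}
    {T : measurableType d} (P : probability T R) (X : T -> 'rV[R]_n) : Prop :=
  same_distribution P P X (fun w => - X w).

Definition independent_vectors {R : realType} {n N : nat}
    {d : measure_display} {T : measurableType d} (P : probability T R)
    (Xs : 'I_N -> T -> 'rV[R]_n) : Prop :=
  forall (J : {set 'I_N}) (B : 'I_N -> set 'rV[R]_n),
    (forall i, borel (B i)) ->
    P (\bigcap_(i in [set` J]) (Xs i @^-1` B i)) =
    (\prod_(i in J) P (Xs i @^-1` B i))%E.

Definition independent_copies {R : realType} {n N : nat}
    {d d' : measure_display} {T : measurableType d} {T' : measurableType d'}
    (P : probability T R) (X : T -> 'rV[R]_n)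
    (P' : probability T' R) (Xs : 'I_N -> T' -> 'rV[R]_n) : Prop :=
  [/\ forall i, random_vector (Xs i),
      forall i, same_distribution P' P (Xs i) X
    & independent_vectors P' Xs].

Definition floating_body {R : realType} {n : nat} {d : measure_display}
    {T : measurableType d} (P : probability T R) (X : T -> 'rV[R]_n)
    (p : R) : set 'rV[R]_n :=
  [set t | (P [set w | (1 <= dotp (X w) t)%R] <= (expR (- p))%:E)%E].

(* Main.v *)
Require Import Defs.
From HB Require Import structures.
From mathcomp Require Import all_boot all_order all_algebra.
From mathcomp Require Import all_classical all_reals all_analysis.
From mathcomp Require Import ring lra zify.

Set Implicit Arguments.
Unset Strict Implicit.
Unset Printing Implicit Defensive.

Import Order.TTheory GRing.Theory Num.Theory.
Import numFieldNormedType.Exports.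

Local Open Scope classical_set_scope.
Local Open Scope ring_scope.

(* Write K for the floating body and e = exp(-p). If x in K° and x/2 is not in
   absconv(X_i), separation gives t with <x,t> > 1 and |<X_i,t>| <= 1/2 for all i.
   Maximising <x,.> over the polytope {|<X_i,t>| <= 1/2, |t_k| <= M}, M large,
   one may take t to be a vertex v; <x,v> > 1 and x in K° force v outside K, i.e.
   P(<X,v> >= 1) > e. A vertex is determined by n of the 2(N+n) constraints, and
   given the at most n points X_j it depends on, the other N-n points are
   independent of it and all satisfy <X_i,v> <= 1/2 with probability at most
   (1-e)^(N-n). The union bound C(2(N+n),n) (1-e)^(N-n) is small enough once N/n
   is large in terms of alpha.
   Instead of conditioning, the points defining the vertex are rounded to a grid
   of mesh tending to 0, which reduces independence to countably many product
   events; the gap between 1/2 and 1 absorbs the rounding error. *)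

(** * Bilinearity, definiteness and continuity of the Euclidean inner product *)

Section DotProduct.
Context {R : realType} {n : nat}.
Implicit Types (x y t : 'rV[R]_n).

Lemma dotpC x t : dotp x t = dotp t x.
Proof. by apply: eq_bigr => i _; rewrite mulrC. Qed.

Lemma dotpDr x t y : dotp x (t + y) = dotp x t + dotp x y.
Proof. by rewrite -big_split; apply: eq_bigr => i _; rewrite mxE mulrDr. Qed.

Lemma dotpZr x (a : R) t : dotp x (a *: t) = a * dotp x t.
Proof. by rewrite mulr_sumr; apply: eq_bigr => i _; rewrite mxE mulrCA. Qed.

Lemma dotpDl x t y : dotp (x + y) t = dotp x t + dotp y t.
Proof. by rewrite !(dotpC _ t) dotpDr. Qed.

Lemma dotpZl x (a : R) t : dotp (a *: x) t = a * dotp x t.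
Proof. by rewrite !(dotpC _ t) dotpZr. Qed.

Lemma dotpNl x t : dotp (- x) t = - dotp x t.
Proof. by rewrite -scaleN1r dotpZl mulN1r. Qed.

Lemma dotpNr x t : dotp x (- t) = - dotp x t.
Proof. by rewrite !(dotpC x) dotpNl. Qed.

Lemma dotp0l t : dotp 0 t = 0.
Proof. by rewrite -(scale0r (0 : 'rV_n)) dotpZl mul0r. Qed.

Lemma dotp_suml (I : finType) (F : I -> 'rV[R]_n) t :
  dotp (\sum_i F i) t = \sum_i dotp (F i) t.
Proof.
by apply: (big_morph (dotp^~ t)) => [x y|]; [exact: dotpDl | exact: dotp0l].
Qed.

Lemma dotp_delta t (k : 'I_n) : dotp (delta_mx 0 k) t = t 0 k.
Proof.
rewrite /dotp (bigD1 k)//= mxE !eqxx mul1r big1 ?addr0// => i ik.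
by rewrite mxE (negPf ik) andbF mul0r.
Qed.

Lemma dotp_subZ t (s : R) y : dotp (t - s *: y) (t - s *: y) =
  dotp t t - 2 * s * dotp y t + s ^+ 2 * dotp y y.
Proof.
rewrite !(dotpDl, dotpDr, dotpNl, dotpNr, dotpZl, dotpZr) (dotpC t y).
by ring.
Qed.

Lemma dotp_ge0 t : 0 <= dotp t t.
Proof. by apply: sumr_ge0 => i _; rewrite -expr2 sqr_ge0. Qed.

Lemma dotp_eq0 t : dotp t t = 0 -> t = 0.
Proof.
move=> /psumr_eq0P t0; apply/rowP => i; rewrite mxE; apply/eqP.
by rewrite -sqrf_eq0 expr2 t0// => j _; rewrite -expr2 sqr_ge0.
Qed.

Lemma cvg_sumr (T : Type) (F : set_system T) {FF : Filter F} (I : Type)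
    (s : seq I) (P : pred I) (f : I -> T -> R) (l : I -> R) :
  (forall i, P i -> f i x @[x --> F] --> l i) ->
  \sum_(i <- s | P i) f i x @[x --> F] --> \sum_(i <- s | P i) l i.
Proof. by move=> fl; apply: cvg_big => //; exact: add_continuous. Qed.

Lemma cvg_dotp (T : Type) (F : set_system T) {FF : Filter F}
    (f g : T -> 'rV[R]_n) x y :
  (forall k, f s 0 k @[s --> F] --> x 0 k) ->
  (forall k, g s 0 k @[s --> F] --> y 0 k) ->
  dotp (f s) (g s) @[s --> F] --> dotp x y.
Proof. by move=> fx gy; apply: cvg_sumr => i _; exact: cvgM. Qed.

Lemma dotp_continuousl t : continuous (dotp^~ t).
Proof.
by move=> x; apply: (@cvg_dotp _ (nbhs x)) => k; [exact: coord_continuous | exact: cvg_cst].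
Qed.

End DotProduct.

(** * Strict separation of a point from an absolute convex hull *)

Section Separation.
Context {R : realType} {n N : nat} (v : 'I_N -> 'rV[R]_n).
Hypothesis N0 : (0 < N)%N.
Implicit Types (b : 'rV[R]_N) (y t : 'rV[R]_n).

Let l1ball : set 'rV[R]_N := [set b | \sum_i `|b 0 i| <= 1].

Let comb b := \sum_i b 0 i *: v i.

(** Each b_i is split into positive and negative parts, weighting v_i and -v_i. The missing mass is
    spread evenly as s over all 2N points, where it cancels in pairs. *)
Lemma absconv_l1comb b : \sum_i `|b 0 i| <= 1 -> absconv v (\sum_i b 0 i *: v i).
Proof.
move=> b1; pose s := (1 - \sum_i `|b 0 i|) / (N + N)%:R.
have NN0 : (N + N)%:R != 0 :> R by rewrite pnatr_eq0; lia.
have s0 : 0 <= s by rewrite divr_ge0 ?subr_ge0.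
exists (N + N)%N, (fun k => match fintype.split k with
    inl i => (`|b 0 i| + b 0 i) / 2 + s | inr i => (`|b 0 i| - b 0 i) / 2 + s end),
  (fun k => match fintype.split k with inl i => v i | inr i => - v i end).
have sl i : fintype.split (lshift N i) = inl i :> 'I_N + 'I_N.
  exact: (unsplitK (inl i)).
have sr i : fintype.split (rshift N i) = inr i :> 'I_N + 'I_N.
  exact: (unsplitK (inr i)).
split.
- move=> k; case: fintype.split => i; rewrite addr_ge0// divr_ge0//.
    by have := ler_norm (- b 0 i); rewrite normrN; lra.
  by have := ler_norm (b 0 i); lra.
- rewrite big_split_ord/= -big_split/=.
  under eq_bigr do rewrite sl sr.
  rewrite (eq_bigr (fun i => `|b 0 i| + (s + s))); last by move=> i _; field.
  rewrite big_split/= sumr_const card_ord -mulr_natr.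
  rewrite -[s + s](mulr_natr s 2) -mulrA -natrM mul2n -addnn /s mulfVK//.
  by rewrite addrC subrK.
- by move=> k; case: fintype.split => i; [left | right]; exists i.
- rewrite big_split_ord/= -big_split/=; apply: eq_bigr => i _.
  by rewrite sl sr scalerN -scalerBl; congr (_ *: _); field.
Qed.

Let l1ball_compact : compact l1ball.
Proof.
apply: bounded_closed_compact.
  exists 1; split => // M M1 b b1; change (mx_norm b <= M); rewrite mx_normrE.
  apply: bigmax_le => [|[i j] _]; first by rewrite (le_trans ler01)// ltW.
  rewrite ord1/= (le_trans _ (ltW M1))// (le_trans _ b1)//.
  by rewrite (bigD1 j)//= lerDl sumr_ge0.
have -> : l1ball = (fun b => \sum_i `|b 0 i|) @^-1` [set x | x <= 1] by [].
apply: closed_comp => [b _|]; last exact: closed_le.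
apply: (@cvg_sumr _ _ (nbhs b)) => i _; apply: cvg_norm; exact: coord_continuous.
Qed.

(** t is y minus the nearest point [comb b], which exists because b ranges over the compact l1
    ball. *)
Lemma absconv_separation y : ~ absconv v y ->
  exists t, forall i, `|dotp (v i) t| < dotp y t.
Proof.
move=> nvy; pose f b := dotp (y - comb b) (y - comb b).
have cf : continuous f.
  have cc k : continuous (fun b => (y - comb b) 0 k).
    rewrite (_ : (fun b => _) = fun b : 'rV_N => y 0 k - \sum_i b 0 i * v i 0 k).
      move=> b; apply: (@cvgB _ _ _ (nbhs b)); first exact: cvg_cst.
      apply: (@cvg_sumr _ _ (nbhs b)) => i _.
      by apply: (@cvgM _ _ (nbhs b)); [exact: coord_continuous | exact: cvg_cst].
    apply/funext => b; rewrite !mxE summxE; congr (_ - _).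
    by apply: eq_bigr => i _; rewrite mxE.
  by move=> b; apply: (@cvg_dotp _ _ _ (nbhs b)) => k; exact: cc.
have [||b] := @EVT_min_rV R N f l1ball _ l1ball_compact.
- by exists 0; rewrite /l1ball/= big1// => i _; rewrite mxE normr0.
- by apply: continuous_subspaceT.
rewrite inE => b1 bmin; exists (y - comb b) => i; set t := y - comb b.
have tt0 : 0 < dotp t t.
  rewrite lt_neqAle dotp_ge0 andbT eq_sym; apply/eqP => /dotp_eq0 t0.
  by apply: nvy; have /eqP := t0; rewrite subr_eq0 => /eqP ->; exact: absconv_l1comb.
(* First-order optimality of the nearest point: the other points of the hull
   lie beyond the hyperplane through it orthogonal to t. *)
have opt (b' : 'rV_N) : l1ball b' -> dotp (comb b') t <= dotp (comb b) t.
  move=> b'1; rewrite leNgt; apply/negP => lt; set z := comb b' - comb b.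
  have zt : 0 < dotp z t by rewrite /z dotpDl dotpNl; lra.
  have fs (s : R) : 0 <= s <= 1 -> 2 * s * dotp z t <= s ^+ 2 * dotp z z.
    move=> /andP[s0 s1]; pose b2 := b + s *: (b' - b).
    have b21 : l1ball b2.
      rewrite /l1ball/=; apply: (@le_trans _ _
          (\sum_i ((1 - s) * `|b 0 i| + s * `|b' 0 i|))).
        apply: ler_sum => j _; rewrite !mxE.
        rewrite -[X in X * `|b 0 j|]ger0_norm ?subr_ge0//.
        rewrite -[X in _ <= _ + X * _]ger0_norm// -!normrM.
        rewrite [X in `|X| <= _](_ : _ = (1 - s) * b 0 j + s * b' 0 j) ?ler_normD//.
        by ring.
      rewrite big_split/= -!mulr_sumr.
      have := ler_wpM2l s0 b'1; rewrite /l1ball/= => h1.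
      have /ler_wpM2l/(_ _ _ b1) : 0 <= 1 - s by lra.
      by move: h1; rewrite !mulr1; lra.
    have : f b <= f b2 by apply: bmin; rewrite inE.
    have -> : f b2 = dotp t t - 2 * s * dotp z t + s ^+ 2 * dotp z z.
      have -> : f b2 = dotp (t - s *: z) (t - s *: z).
        rewrite /f; suff -> : y - comb b2 = t - s *: z by [].
        rewrite /t /z /comb -sumrB scaler_sumr -!addrA -opprD -big_split/=.
        congr (_ - _); apply: eq_bigr => j _.
        by rewrite !mxE scalerDl -scalerBl scalerA.
      exact: dotp_subZ.
    by rewrite /f -/t; lra.
  have zz0 : 0 < dotp z z.
    by have := fs 1; rewrite ler01 lexx => /(_ isT); lra.
  (* The minimiser <z,t>/<z,z> of the quadratic, or s = 1 when that is at least 1, contradicts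
     [fs]. *)
  have [le|le] := leP (dotp z z) (dotp z t).
    by have := fs 1; rewrite ler01 lexx => /(_ isT); lra.
  have := fs (dotp z t / dotp z z).
  rewrite divr_ge0 ?(ltW zt) ?(ltW zz0)//= ler_pdivrMr// mul1r (ltW le) => /(_ isT).
  rewrite -subr_ge0 (_ : _ - _ = - (dotp z t ^+ 2 / dotp z z)); last first.
    by field; rewrite gt_eqF.
  by rewrite oppr_ge0 leNgt divr_gt0 ?exprn_gt0.
(* [opt] is tested at plus and minus the unit vectors; strictness comes from <y,t> = <comb b,t> +
   <t,t>. *)
have vi (e : R) : `|e| = 1 -> e * dotp (v i) t < dotp y t.
  move=> e1; have := opt (e *: delta_mx 0 i).
  have -> : comb (e *: delta_mx 0 i) = e *: v i.
    rewrite /comb (bigD1 i)//= !mxE !eqxx mulr1 big1 ?addr0// => j ji.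
    by rewrite !mxE (negPf ji) andbF mulr0 scale0r.
  rewrite dotpZl => /(_ _)/le_lt_trans; apply.
    rewrite /l1ball/= (bigD1 i)//= big1 => [|j ji].
      by rewrite !mxE !eqxx mulr1 addr0 e1.
    by rewrite !mxE (negPf ji) andbF mulr0 normr0.
  by move: tt0; rewrite {1}/t dotpDl dotpNl; lra.
have := vi 1; rewrite normr1 mul1r => /(_ erefl) h1.
have := vi (-1); rewrite normrN1 mulN1r => /(_ erefl) h2.
by rewrite ltr_norml; apply/andP; split; lra.
Qed.

End Separation.

(** * Vertices of bounded polyhedra and their Cramer formula *)

Section Vertex.
Context {R : realType} {n : nat} {I : finType}.
Variables (a : I -> 'rV[R]_n) (b : I -> R) (c : 'rV[R]_n).
Implicit Types (t u : 'rV[R]_n).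

(** The matrix with rows a_i has rank below n, hence a nonzero kernel. *)
Lemma orthogonal_of_few (s : seq I) : (size s < n)%N ->
  exists2 u, u != 0 & forall i, i \in s -> dotp (a i) u = 0.
Proof.
move=> sn; pose A : 'M[R]_(size s, n) := \matrix_(j < size s) a (tnth (in_tuple s) j).
have : kermx A^T != 0.
  by rewrite -mxrank_eq0 mxrank_ker -lt0n subn_gt0 mxrank_tr
    (leq_ltn_trans (rank_leq_row _)).
move=> /rowV0Pn[u /sub_kermxP uA u0]; exists u => // i.
move=> /(tnthP (in_tuple s))[j ->].
have /rowP/(_ j) := uA; rewrite !mxE => <-; rewrite /dotp.
by apply: eq_bigr => k _; rewrite !mxE mulrC.
Qed.

Lemma span_orthogonal (s : seq I) u :
  (forall i, i \in s -> dotp (a i) u = 0) ->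
  forall x, x \in <<[seq a i | i <- s]>>%VS -> dotp x u = 0.
Proof.
move=> su x xs; rewrite (coord_span (X := in_tuple [seq a i | i <- s]) xs).
rewrite dotp_suml big1// => j _; rewrite dotpZl.
have /mapP[i si ->] : ([seq a i | i <- s])`_j \in [seq a i | i <- s].
  exact: mem_nth.
by rewrite su ?mulr0.
Qed.

(** No nonzero direction is a recession direction of the polyhedron, so every ray eventually leaves
    it. *)
Hypothesis bounded_dir : forall u, u != 0 -> exists i, 0 < dotp (a i) u.

(* Moving from a feasible point orthogonally to the tight constraints, in the
   direction where c does not decrease, makes a new constraint tight. *)
Lemma tight_constraints t m : (m <= n)%N ->
  (forall i, dotp (a i) t <= b i) ->
  exists (s : seq I) t', [/\ size s = m, free [seq a i | i <- s],
    forall i, i \in s -> dotp (a i) t' = b i, forall i, dotp (a i) t' <= b i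
    & dotp c t <= dotp c t'].
Proof.
elim: m => [_ tb|m IHm mn tb].
  by exists [::], t; split => //; rewrite nil_free.
have [s [t' [sm fs st' t'b ct]]] := IHm (ltnW mn) tb.
have [u u0 [su cu]] : exists2 u, u != 0 &
    (forall i, i \in s -> dotp (a i) u = 0) /\ 0 <= dotp c u.
  have [|u u0 su] := @orthogonal_of_few s; first by rewrite sm.
  have [cu|cu] := leP 0 (dotp c u); first by exists u.
  exists (- u); first by rewrite oppr_eq0.
  by split => [i si|]; rewrite dotpNr ?su ?oppr0// oppr_ge0 ltW.
have [i0 ui0] := bounded_dir u0.
pose F i := (b i - dotp (a i) t') / dotp (a i) u.
have [i ui imin] := @arg_minP _ _ _ i0 (fun i => 0 < dotp (a i) u) F ui0.
have Fi0 : 0 <= F i by rewrite divr_ge0 ?subr_ge0// ltW.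
exists (i :: s), (t' + F i *: u); split.
- by rewrite /= sm.
(* u is orthogonal to the span of the old constraints but not to a_i, so a_i is new. *)
- rewrite /= free_cons fs andbT; apply/negP => /(span_orthogonal su) ui0'.
  by rewrite ui0' ltxx in ui.
- move=> j; rewrite inE dotpDr dotpZr => /predU1P[->|js].
    by rewrite /F divfK ?gt_eqF// addrC subrK.
  by rewrite su// mulr0 addr0 st'.
- move=> j; rewrite dotpDr dotpZr; have [uj|uj] := ltP 0 (dotp (a j) u).
    have := imin j uj; rewrite -(ler_pM2r uj) {2}/F divfK ?gt_eqF//; lra.
  by have := t'b j; have := mulr_ge0_le0 Fi0 uj; lra.
- by rewrite dotpDr dotpZr (le_trans ct)// lerDl mulr_ge0.
Qed.

(* Meaningful for #|J| = n only; vertex_pt is then the solution, by Cramer's rule,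
   of the system <a_i, t> = b_i, i in J. *)
Definition vertex_mx (J : {set I}) : 'M[R]_n :=
  \matrix_(k, j) (nth 0 [seq a i | i <- enum J] j) 0 k.

Definition vertex_pt (J : {set I}) : 'rV[R]_n :=
  (\det (vertex_mx J))^-1 *:
  ((\row_j nth 0 [seq b i | i <- enum J] j) *m \adj (vertex_mx J)).

(** n independent tight constraints form an invertible system, so the point reached is [vertex_pt]
    of their index set. Passing from a list to a set leaves only binomially many candidates for the
    union bound. *)
Lemma exists_vertex t : (forall i, dotp (a i) t <= b i) ->
  exists J : {set I}, [/\ #|J| = n, \det (vertex_mx J) != 0,
    forall i, dotp (a i) (vertex_pt J) <= b i
    & dotp c t <= dotp c (vertex_pt J)].
Proof.
move=> tb; have [s [t' [sn fs st' t'b ct]]] := tight_constraints (leqnn n) tb.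
have us : uniq s by apply: (@map_uniq _ _ a); exact: free_uniq fs.
pose J : {set I} := [set i in s].
have Js : perm_eq (enum J) s.
  by apply: uniq_perm => //; [exact: enum_uniq | move=> i; rewrite mem_enum inE].
have Jn : #|J| = n by rewrite cardE (perm_size Js).
have mulV (x : 'rV[R]_n) : x *m vertex_mx J
    = \row_j (nth 0 [seq dotp (a i) x | i <- enum J] j).
  apply/rowP => j; rewrite !mxE.
  have jJ : (j < size (enum J))%N by rewrite -cardE Jn.
  have i0 : I by case: (enum J) jJ => // i.
  rewrite (nth_map i0)//; apply: eq_bigr => k _.
  by rewrite mxE (nth_map i0)// mulrC.
(* A kernel vector is orthogonal to all a_i with i in s; these span the whole space by dimension, so
   it is orthogonal to itself. *)
have d0 : \det (vertex_mx J) != 0.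
  apply/det0P => -[x x0 xV]; case/negP: x0; apply/eqP/dotp_eq0.
  apply: (@span_orthogonal s x).
    move=> i; rewrite -(perm_mem Js) => iJ.
    have iJn : (index i (enum J) < n)%N by rewrite -Jn cardE index_mem.
    have /rowP/(_ (Ordinal iJn)) := xV; rewrite mulV !mxE/=.
    by rewrite (nth_map i) ?index_mem// nth_index.
  suff -> : <<[seq a i | i <- s]>>%VS = fullv by exact: memvf.
  apply/eqP; rewrite eqEdim subvf dimvf /dim/= mul1n.
  by move: fs; rewrite /free size_map sn => /eqP ->.
suff Jt' : vertex_pt J = t' by exists J; split; rewrite ?Jt'.
rewrite /vertex_pt.
have -> : \row_j (nth 0 [seq b i | i <- enum J] j) = t' *m vertex_mx J.
  rewrite mulV; apply/rowP => j; rewrite !mxE.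
  congr (nth 0 _ j); apply/eq_in_map => i.
  by rewrite (perm_mem Js) => /st' ->.
by rewrite -mulmxA mul_mx_adj mul_mx_scalar scalerA mulVf// scale1r.
Qed.

End Vertex.

(** * Continuous dependence of a vertex on the constraint vectors *)

Section VertexContinuity.
Context {R : realType} {T : Type} {F : set_system T} {FF : Filter F}.

Lemma cvg_det n (A : T -> 'M[R]_n) (B : 'M[R]_n) :
  (forall i j, A s i j @[s --> F] --> B i j) -> \det (A s) @[s --> F] --> \det B.
Proof.
move=> AB; apply: cvg_sumr => s _; apply: cvgM; first exact: cvg_cst.
by apply: cvg_big => //; exact: mul_continuous.
Qed.

Lemma cvg_adj n (A : T -> 'M[R]_n) (B : 'M[R]_n) :
  (forall i j, A s i j @[s --> F] --> B i j) ->
  forall i j, (\adj (A s)) i j @[s --> F] --> (\adj B) i j.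
Proof.
move=> AB i j; rewrite mxE (_ : (fun s => _) = fun s => cofactor (A s) j i).
  apply: cvgM; first exact: cvg_cst.
  apply: cvg_det => k l; rewrite !mxE (_ : (fun s => _) =
    fun s => A s (lift j k) (lift i l)); first exact: AB.
  by apply/funext => s; rewrite !mxE.
by apply/funext => s; rewrite mxE.
Qed.

(** Cramer's formula is rational in the coordinates, with a denominator that does not vanish at the
    limit. *)
Lemma cvg_vertex_pt n (I : finType) (a : T -> I -> 'rV[R]_n) (a' : I -> 'rV[R]_n)
    (b : I -> R) (J : {set I}) :
  (forall i k, a s i 0 k @[s --> F] --> a' i 0 k) ->
  \det (vertex_mx a' J) != 0 ->
  forall k, vertex_pt (a s) b J 0 k @[s --> F] --> vertex_pt a' b J 0 k.
Proof.
move=> aa' d0 k.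
have aV i j : vertex_mx (a s) J i j @[s --> F] --> vertex_mx a' J i j.
  rewrite mxE (_ : (fun s => _) =
    fun s => (nth 0 [seq a s i | i <- enum J] j) 0 i); last first.
    by apply/funext => s; rewrite mxE.
  have [jJ|Jj] := ltnP j (size (enum J)); last first.
    rewrite nth_default ?size_map// (_ : (fun s => _) = cst ((0 : 'rV_n) 0 i)).
      exact: cvg_cst.
    by apply/funext => s; rewrite nth_default ?size_map.
  have i0 : I by case: (enum J) jJ => // i0.
  rewrite (nth_map i0)// (_ : (fun s => _) = fun s => a s (nth i0 (enum J) j) 0 i).
    exact: aa'.
  by apply/funext => s; rewrite (nth_map i0).
rewrite mxE [X in _ * X]mxE (_ : (fun s => _) = fun s => (\det (vertex_mx (a s) J))^-1 *
    \sum_j (\row_j nth 0 [seq b i | i <- enum J] j) 0 j *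
            (\adj (vertex_mx (a s) J)) j k); last first.
  by apply/funext => s; rewrite mxE [X in _ * X]mxE.
apply: cvgM; first by apply: cvgV => //; exact: cvg_det.
apply: cvg_sumr => j _; apply: cvgM; first exact: cvg_cst.
exact: cvg_adj.
Qed.

End VertexContinuity.

(** Rounding down to mesh 1/(h+1) moves x by less than 1/(h+1). *)
Lemma cvg_floor_grid (R : realType) (x : R) :
  (Num.floor (h.+1%:R * x))%:~R / h.+1%:R @[h --> \oo] --> x.
Proof.
apply: (@squeeze_cvgr _ _ _ _ (fun h => x - h.+1%:R^-1) (fun=> x)).
- apply: nearW => h; have h0 : 0 < h.+1%:R :> R by [].
  rewrite ler_pdivlMr// ler_pdivrMr// mulrBl mulVf ?gt_eqF//.
  rewrite (mulrC x) Num.Theory.floor_le andbT lerBlDr ltW//.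
  by have := floorD1_gt (h.+1%:R * x); rewrite intrD.
- rewrite -[X in _ --> X]subr0; apply: cvgB; first exact: cvg_cst.
  exact: cvg_harmonic.
- exact: cvg_cst.
Qed.

(** * Lower limits of events, outer bounds and total probability *)

Section MeasureLemmas.
Context {R : realType} {d : measure_display} {T : measurableType d}.
Variable P : probability T R.
Local Open Scope ereal_scope.

Lemma measure_bigcup_nondecreasing_le (F : (set T)^nat) (c : \bar R) :
  (forall h, measurable (F h)) -> {homo F : m n / (m <= n)%N >-> m `<=` n} ->
  (forall h, P (F h) <= c) -> P (\bigcup_h F h) <= c.
Proof.
move=> mF ndF Fc.
have PF : P (F h) @[h --> \oo] --> P (\bigcup_h F h).
  apply: nondecreasing_cvg_mu => //; first exact: bigcupT_measurable.
  by move=> m n mn; apply/subsetPset/ndF.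
rewrite -(cvg_lim _ PF)//; apply: lime_le; last exact: nearW.
by apply/cvg_ex; eexists; exact: PF.
Qed.

(** The union of these sets over H is the lower limit of the sequence E. *)
Definition tail_inter (E : (set T)^nat) H := \bigcap_(h in [set h | (H <= h)%N]) E h.

Lemma tail_inter_measurable (E : (set T)^nat) H :
  (forall h, measurable (E h)) -> measurable (tail_inter E H).
Proof. by move=> mE; apply: bigcap_measurableType. Qed.

Lemma tail_inter_nondecreasing (E : (set T)^nat) :
  {homo tail_inter E : m n / (m <= n)%N >-> m `<=` n}.
Proof. by move=> m n mn w Ew h /= nh; apply: Ew => /=; exact: leq_trans nh. Qed.

(** If P (E h) <= c for arbitrarily large h, every tail intersection has measure at most c, hence so
    has their increasing union, which contains A. *)
Lemma measure_liminf_gt (A : set T) (E : (set T)^nat) (c : R) :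
  measurable A -> (forall h, measurable (E h)) ->
  (forall w, A w -> exists H, forall h, (H <= h)%N -> E h w) ->
  c%:E < P A -> exists H, forall h, (H <= h)%N -> c%:E < P (E h).
Proof.
move=> mA mE AE cA; apply: contrapT => /forallNP noH.
have : P (\bigcup_h tail_inter E h) <= c%:E.
  apply: measure_bigcup_nondecreasing_le.
  - by move=> H; exact: tail_inter_measurable.
  - exact: tail_inter_nondecreasing.
  - move=> H; have /existsNP[h /not_implyP[Hh /negP]] := noH H.
    rewrite -leNgt; apply: le_trans; apply: le_measure; rewrite ?inE//.
      exact: tail_inter_measurable.
    by move=> w; apply.
apply/negP; rewrite -ltNge (lt_le_trans cA)//; apply: le_measure; rewrite ?inE//.
  by apply: bigcupT_measurable => H; exact: tail_inter_measurable.
by move=> w /AE[H EH]; exists H => // h /= Hh; exact: EH.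
Qed.

(** A bound on outer probability: it lets events such as [bad_vertex] enter the union bound without
    a proof that they are measurable. *)
Definition outer_le (A : set T) (c : R) :=
  exists B, [/\ measurable B, A `<=` B & P B <= c%:E].

Lemma outer_le_liminf (A : set T) (E : (set T)^nat) (c : R) :
  (forall h, outer_le (E h) c) ->
  (forall w, A w -> exists H, forall h, (H <= h)%N -> E h w) ->
  outer_le A c.
Proof.
move=> /choice[B EB] AE.
have mB h : measurable (B h) by have [] := EB h.
exists (\bigcup_h tail_inter B h); split.
- by apply: bigcupT_measurable => H; exact: tail_inter_measurable.
- move=> w /AE[H EH]; exists H => // h /= Hh.
  by have [_ + _] := EB h; apply; exact: EH.
- apply: measure_bigcup_nondecreasing_le.
  + by move=> H; exact: tail_inter_measurable.
  + exact: tail_inter_nondecreasing.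
  + move=> H; have [_ _] := EB H; apply: le_trans; apply: le_measure; rewrite ?inE//.
      exact: tail_inter_measurable.
    by move=> w; apply => /=.
Qed.

Lemma outer_le_bigcup (I : finType) (D : {set I}) (A : I -> set T) (c : R) :
  (forall i, i \in D -> outer_le (A i) c) ->
  outer_le (\bigcup_(i in [set` D]) A i) (#|D|%:R * c).
Proof.
move=> Ac.
suff: outer_le (\bigcup_(i in [set` enum D]) A i) ((size (enum D))%:R * c).
  rewrite -cardE (_ : [set` enum D] = [set` D])//.
  by apply/seteqP; split => i /=; rewrite mem_enum.
have : {subset enum D <= D} by move=> i; rewrite mem_enum.
elim: (enum D) => [_|i s IHs sD].
  by exists set0; split => //; [move=> w [] | rewrite measure0 mul0r].
have [|B [mB sB Bc]] := IHs; first by move=> j js; apply: sD; rewrite inE js orbT.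
have [C [mC iC Cc]] := Ac i (sD i (mem_head _ _)).
exists (C `|` B); split; first exact: measurableU.
- move=> w [j /=]; rewrite inE => /predU1P[-> /iC|js Aj]; first by left.
  by right; apply: sB; exists j.
- rewrite (le_trans (measureU2 _ mC mB))// -natr1 mulrDl mul1r addrC EFinD.
  exact: leeD.
Qed.

Lemma outer_leW (A B : set T) (b c : R) : A `<=` B -> (b <= c)%R ->
  outer_le B b -> outer_le A c.
Proof.
move=> AB bc [C [mC BC Cb]]; exists C; split => //; first exact: subset_trans BC.
by rewrite (le_trans Cb)// lee_fin.
Qed.

(** Total probability over the disjoint cells C: given C z, the event D z has probability at most q,
    and the masses of the cells sum to at most 1. *)
Lemma measure_cells_le (Z : countType) (C D : Z -> set T) (q : R) : (0 <= q)%R ->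
  (forall z, measurable (C z)) -> (forall z, measurable (D z)) ->
  (forall z, D z `<=` C z) -> trivIset setT C ->
  (forall z, P (D z) <= q%:E * P (C z)) ->
  outer_le (\bigcup_z D z) q.
Proof.
move=> q0 mC mD DC tC PDC.
(* The family is transported along [pickle] to a sequence, empty at integers that code no
   element. *)
pose ext (G : Z -> set T) k := if pickle_inv k is Some z then G z else set0.
have mext G : (forall z, measurable (G z)) -> forall k, measurable (ext G k).
  by move=> mG k; rewrite /ext; case: pickle_inv.
have text G : (forall z, G z `<=` C z) -> trivIset setT (ext G).
  move=> GC k l _ _ [w []]; rewrite /ext.
  case Ek : pickle_inv => [z|//] Gz; case El : pickle_inv => [z'|//] Gz'.
  have zz' : z = z' by apply: tC => //; exists w; split; exact: GC.
  by have := @pickle_invK Z k; have := @pickle_invK Z l; rewrite Ek El zz' /= => <- <-.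
have -> : \bigcup_z D z = \bigcup_k ext D k.
  apply/seteqP; split=> w [z _ Dz].
    by exists (pickle z) => //; rewrite /ext pickleK_inv.
  by move: Dz; rewrite /ext; case: pickle_inv => // z' Dz'; exists z'.
exists (\bigcup_k ext D k); split => //; first by apply: bigcupT_measurable; exact: mext.
have PE G : (forall z, measurable (G z)) -> (forall z, G z `<=` C z) ->
    P (\bigcup_k ext G k) = \sum_(0 <= k <oo | k \in setT) P (ext G k).
  by move=> mG GC; apply: measure_bigcup => [k _|]; [exact: mext | exact: text].
rewrite PE//.
apply: (@le_trans _ _ (\sum_(0 <= k <oo | k \in setT) (q%:E * P (ext C k)))).
  apply: lee_nneseries => [//|k _]; rewrite /ext; case: pickle_inv => //.
  by rewrite !measure0 mule0.
rewrite nneseriesZl// -(PE C mC (fun z => @subset_refl _ (C z))).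
rewrite -[leRHS]mule1; apply: lee_pmul => //; apply: probability_le1.
by apply: bigcupT_measurable; exact: mext.
Qed.

End MeasureLemmas.

(** * Borel sets of vectors: half-spaces and grid cells *)

Section Borel.
Context {R : realType} {n : nat}.

Lemma borel_open (A : set 'rV[R]_n) : open A -> borel A.
Proof. by move=> oA; exact: sub_sigma_algebra. Qed.

Lemma borel_closed (A : set 'rV[R]_n) : closed A -> borel A.
Proof.
move=> cA; rewrite -[A]setCK.
apply: (@measurableC _ (g_sigma_algebraType (@open 'rV[R]_n))).
by apply: borel_open; exact: closed_openC.
Qed.

Lemma borel_halfspace_ge (c : R) t : borel [set y : 'rV[R]_n | c <= dotp y t].
Proof.
apply: borel_closed; rewrite (_ : mkset _ = (dotp^~ t) @^-1` [set x | c <= x])//.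
by apply: closed_comp => [y _|]; [exact: dotp_continuousl | exact: closed_ge].
Qed.

Lemma borel_halfspace_lt (c : R) t : borel [set y : 'rV[R]_n | dotp y t < c].
Proof.
apply: borel_open; rewrite (_ : mkset _ = (dotp^~ t) @^-1` [set x | x < c])//.
by apply: open_comp => [y _|]; [exact: dotp_continuousl | exact: open_lt].
Qed.

Lemma borel_grid_cell (c : R) (z : 'rV[int]_n) :
  borel [set y : 'rV[R]_n | forall k, Num.floor (c * y 0 k) = z 0 k].
Proof.
rewrite (_ : mkset _ = \bigcap_(k in [set: 'I_n])
   ([set y | (z 0 k)%:~R <= dotp y (c *: delta_mx 0 k)] `&`
    [set y | dotp y (c *: delta_mx 0 k) < (z 0 k + 1)%:~R])).
  apply: (@fin_bigcap_measurable _ (g_sigma_algebraType (@open 'rV[R]_n))) => //.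
  move=> k _; apply: (@measurableI _ (g_sigma_algebraType (@open 'rV[R]_n))).
    exact: borel_halfspace_ge.
  exact: borel_halfspace_lt.
apply/seteqP; split => y /= yz k.
  move=> _; rewrite /= dotpZr dotpC dotp_delta -yz.
  by split; [exact: Num.Theory.floor_le | exact: floorD1_gt].
have [] := yz k I; rewrite /= dotpZr dotpC dotp_delta => h1 h2.
by apply/eqP; rewrite floor_eq h1.
Qed.

End Borel.

(** * The random polytope and the sample points that determine a vertex *)

Section Vertices.
Context {R : realType} {n N : nat}.
Implicit Types (x y : 'I_N -> 'rV[R]_n) (J : {set bool * ('I_N + 'I_n)}).

(* The constraints |<x_i, t>| <= 1/2 and |t_k| <= M as one-sided ones; the
   latter guarantee that the polytope they define is bounded. *)
Definition constr x (i : bool * ('I_N + 'I_n)) : 'rV[R]_n :=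
  let y := match i.2 with inl j => x j | inr k => delta_mx 0 k end in
  if i.1 then y else - y.

Definition bnd (M : R) (i : bool * ('I_N + 'I_n)) : R :=
  match i.2 with inl _ => 2^-1 | inr _ => M end.

Definition points_of J : {set 'I_N} := [set j | inl j \in snd @: J]%SET.

Lemma card_points_of J : (#|points_of J| <= #|J|)%N.
Proof.
apply: leq_trans (leq_imset_card snd J).
rewrite -(card_imset (mem (points_of J)) (f := @inl 'I_N 'I_n)); last by move=> ? ? [].
by apply: subset_leq_card; apply/fintype.subsetP => _ /imsetP[j + ->]; rewrite inE.
Qed.

(** This is what makes independence usable: the vertex is a function of the points indexed by
    [points_of J] alone. *)
Lemma eq_vertex_pt x y M J : {in points_of J, x =1 y} ->
  vertex_pt (constr x) (bnd M) J = vertex_pt (constr y) (bnd M) J.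
Proof.
move=> xy; suff e : vertex_mx (constr x) J = vertex_mx (constr y) J.
  by rewrite /vertex_pt e.
suff e : [seq constr x i | i <- enum J] = [seq constr y i | i <- enum J].
  by apply/matrixP => k j; rewrite !mxE e.
apply/eq_in_map => -[b [i|i]]; rewrite mem_enum => iJ //.
by rewrite /constr/= xy// inE; apply/imsetP; exists (b, inl i).
Qed.

Lemma constr_bounded x u : u != 0 -> exists i, 0 < dotp (constr x i) u.
Proof.
move=> /rV0Pn[k uk]; have [uk0|uk0] := ltP 0 (u 0 k).
  by exists (true, inr k); rewrite /constr/= dotp_delta.
by exists (false, inr k); rewrite /constr/= dotpNl dotp_delta oppr_gt0 lt_neqAle uk.
Qed.

End Vertices.

(** * Probability that a given set of constraints yields a bad vertex *)

Section BadVertex.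
Context {R : realType} {n N : nat} {d d' : measure_display}.
Context {T : measurableType d} {T' : measurableType d'}.
Variables (P : probability T R) (X : T -> 'rV[R]_n).
Variables (P' : probability T' R) (Xs : 'I_N -> T' -> 'rV[R]_n).
Hypotheses (mX : random_vector X) (copies : independent_copies P X P' Xs).
Variable e : R.
Hypothesis e01 : 0 <= e <= 1.

Let mXs i : random_vector (Xs i). Proof. by case: copies. Qed.

Lemma prob_copy_lt i v c : (e%:E < P [set w | (c <= dotp (X w) v)%R])%E ->
  (P' (Xs i @^-1` [set y | (dotp y v < c)%R]) <= (1 - e)%:E)%E.
Proof.
move=> ev; have [_ /(_ i) sd _] := copies.
rewrite sd; last exact: borel_halfspace_lt.
have mc := mX (borel_halfspace_ge c v).
rewrite (_ : _ @^-1` _ = ~` (X @^-1` [set y | c <= dotp y v])).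
  rewrite probability_setC// EFinB leeB// ltW//.
by apply/seteqP; split => w /=; rewrite ltNge => /negP.
Qed.

Variables (M : R) (J : {set bool * ('I_N + 'I_n)}).
Let U := points_of J.

(** With e = exp(-p), the middle condition puts the vertex outside the floating body. The nonzero
    determinant makes the vertex continuous in the points, as the rounding argument requires. *)
Definition bad_vertex : set T' := [set w |
  let v := vertex_pt (constr (fun i => Xs i w)) (bnd M) J in
  [/\ \det (vertex_mx (constr (fun i => Xs i w)) J) != 0,
      (e%:E < P [set w | (1 <= dotp (X w) v)%R])%E
    & forall i, dotp (Xs i w) v <= 2^-1]].

Section Grid.
Variable h : nat.
Implicit Type z : {ffun 'I_N -> 'rV[int]_n}.

Let grid_pt z i : 'rV[R]_n := \row_k ((z i 0 k)%:~R / h.+1%:R).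
Let v z := vertex_pt (constr (grid_pt z)) (bnd M) J.
Let cell z i := [set y : 'rV[R]_n | forall k, Num.floor (h.+1%:R * y 0 k) = z i 0 k].
(* Fixing z = 0 off U makes the cells C z pairwise disjoint. *)
Let grid_ok z := [forall i, (i \in U) || (z i == 0)].
(** The threshold 3/4 lies strictly between 1/2 and 1: after a fine enough rounding, <X_i,v> <= 1/2
    still gives < 3/4, and P(<X,v> >= 1) > e still gives P(<X,v> >= 3/4) > e. *)
Let bad_pt z := `[< (e%:E < P [set w | (3 / 4 <= dotp (X w) (v z))%R])%E >].
Let box z i := if i \in U then cell z i else [set y | dotp y (v z) < 3 / 4].

(** On [C z] the points indexed by U round to z, so the rounded vertex is the deterministic vector
    [v z]. [D z] adds that [v z] is bad and that all other points lie on its low side. *)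
Let C z := if grid_ok z then \bigcap_(i in [set` U]) (Xs i @^-1` cell z i) else set0.
Let D z := if grid_ok z && bad_pt z then
  \bigcap_(i in [set` [set: 'I_N]%SET]) (Xs i @^-1` box z i) else set0.

Definition grid_event : set T' := \bigcup_z D z.

Let borel_box z i : borel (box z i).
Proof.
by rewrite /box; case: ifP => _; [exact: borel_grid_cell | exact: borel_halfspace_lt].
Qed.

(** Independence turns both P'(C z) and P'(D z) into products. The factors over U agree, and each of
    the other N - #|U| factors of P'(D z) is at most 1 - e because [v z] is fixed. *)
Lemma grid_event_outer_le : outer_le P' grid_event ((1 - e) ^+ (N - #|U|)).
Proof.
have e1 : 0 <= 1 - e by case/andP: e01; rewrite subr_ge0.
have PF A : measurable A -> P' A = (fine (P' A))%:E.
  by move=> mA; rewrite fineK// fin_num_measure.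
apply: (@measure_cells_le _ _ _ _ _ C); first by rewrite exprn_ge0.
- move=> z; rewrite /C; case: ifP => // _.
  by apply: fin_bigcap_measurable => // i _; apply: mXs; exact: borel_grid_cell.
- move=> z; rewrite /D; case: ifP => // _.
  by apply: fin_bigcap_measurable => // i _; apply: mXs.
- move=> z w; rewrite /D /C; case: grid_ok => //=; case: bad_pt => //= Dw i iU.
  by have := Dw i; rewrite /= inE => /(_ isT); rewrite /box iU.
- move=> z z' _ _ [w []]; rewrite /C.
  case: (boolP (grid_ok z)) => // /forallP oz Cz.
  case: (boolP (grid_ok z')) => // /forallP oz' Cz'.
  apply/ffunP => i; have := oz i; have := oz' i; case: (boolP (i \in U)) => /= iU.
    by move=> _ _; apply/rowP => k; rewrite -(Cz i iU k) -(Cz' i iU k).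
  by move=> /eqP -> /eqP ->.
- move=> z; rewrite /C /D; case: grid_ok => /=; last by rewrite measure0 mule0.
  case: (boolP (bad_pt z)) => [/asboolP bz|_]; last first.
    by rewrite measure0 mule_ge0// lee_fin exprn_ge0.
  have [_ _ indep] := copies.
  rewrite indep//; rewrite indep; last by move=> i; exact: borel_grid_cell.
  rewrite (eq_bigr (fun i => (fine (P' (Xs i @^-1` box z i)))%:E)); last first.
    by move=> i _; rewrite -PF//; exact: mXs.
  rewrite [X in (_ <= _ * X)%E](eq_bigr
      (fun i => (fine (P' (Xs i @^-1` box z i)))%:E)); last first.
    by move=> i iU; rewrite /box iU -PF//; apply: mXs; exact: borel_grid_cell.
  rewrite !prodEFin -EFinM lee_fin (bigID (mem U))/= mulrC.
  apply: ler_pM.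
  + by apply: prodr_ge0 => i _; rewrite fine_ge0.
  + by apply: prodr_ge0 => i _; rewrite fine_ge0.
  + have NU : (N - #|U|)%N = #|[predC U]|.
      have : (#|U| + #|[predC U]|)%N = N by rewrite cardC card_ord.
      by lia.
    rewrite NU -prodr_const.
    rewrite [leLHS](eq_bigl (mem [predC U])) => [|i]; last by rewrite !inE.
    apply: ler_prod => i /=; rewrite inE => /negPf iU; rewrite fine_ge0//=.
    by rewrite -lee_fin -PF; [rewrite /box iU; exact: prob_copy_lt | exact: mXs].
  + by rewrite [leLHS](eq_bigl (mem U)) => [//|i]; rewrite !inE.
Qed.

End Grid.

(** The rounded vertices [v h] converge to V, so both inequalities survive for large h at the
    relaxed threshold 3/4. *)
Lemma bad_vertex_grid w : bad_vertex w ->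
  exists H, forall h, (H <= h)%N -> grid_event h w.
Proof.
move=> [d0]; set V := vertex_pt _ _ _ => eP Xv.
pose x h i : 'rV[R]_n :=
  \row_k ((Num.floor (h.+1%:R * Xs i w 0 k))%:~R / h.+1%:R).
pose v h := vertex_pt (constr (x h)) (bnd M) J.
have vV k : v h 0 k @[h --> \oo] --> V 0 k.
  apply: cvg_vertex_pt => // -[b i] l; have xX : constr (x h) (true, i) 0 l @[h --> \oo]
      --> constr (fun i => Xs i w) (true, i) 0 l.
    case: i => i; rewrite /constr/=; last exact: cvg_cst.
    rewrite (_ : (fun h => _) = fun h =>
      (Num.floor (h.+1%:R * Xs i w 0 l))%:~R / h.+1%:R); first exact: cvg_floor_grid.
    by apply/funext => h; rewrite mxE.
  case: b => //; rewrite /constr/= mxE.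
  rewrite (_ : (fun h => _) = fun h => - constr (x h) (true, i) 0 l).
    by apply: cvgN; exact: xX.
  by apply/funext => h; rewrite mxE.
have cstx (y : 'rV[R]_n) k : y 0 k @[_ --> \oo] --> y 0 k by exact: cvg_cst.
have [H1 _ H1v] : \forall h \near \oo, forall i, dotp (Xs i w) (v h) < 3 / 4.
  apply: filter_forall => i.
  have : dotp (Xs i w) (v h) @[h --> \oo] --> dotp (Xs i w) V by exact: cvg_dotp.
  by move=> /cvgr_lt; apply; rewrite (le_lt_trans (Xv i))//; lra.
have [||w'|H2 H2v] := @measure_liminf_gt _ _ _ P _
    (fun h => [set w | 3 / 4 <= dotp (X w) (v h)]) e _ _ _ eP.
- exact: (mX (borel_halfspace_ge 1 V)).
- by move=> h; exact: (mX (borel_halfspace_ge (3 / 4) (v h))).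
- move=> /= Xw'.
  have : dotp (X w') (v h) @[h --> \oo] --> dotp (X w') V by exact: cvg_dotp.
  move=> /cvgr_ge/(_ (3 / 4)) []; first by rewrite (lt_le_trans _ Xw')//; lra.
  by move=> H _ Hv; exists H => h Hh; exact: Hv.
exists (maxn H1 H2) => h; rewrite geq_max => /andP[/H1v/= hv /H2v Pv].
(* Off U the value 0 is what [grid_ok] demands; the vertex does not see it, by [eq_vertex_pt]. *)
pose z : {ffun 'I_N -> 'rV[int]_n} :=
  [ffun i => if i \in U then \row_k Num.floor (h.+1%:R * Xs i w 0 k) else 0].
have vz : vertex_pt (constr (fun i => \row_k ((z i 0 k)%:~R / h.+1%:R))) (bnd M) J
    = v h.
  by apply: eq_vertex_pt => i iU; apply/rowP => k; rewrite !mxE ffunE iU mxE.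
exists z => //; rewrite ifT; last first.
  apply/andP; split; last by apply/asboolP; rewrite vz.
  by apply/forallP => i; rewrite ffunE; case: (i \in U) => //=.
move=> i _ /=; case: (boolP (i \in U)) => iU /=; last by rewrite vz.
by move=> k; rewrite ffunE iU mxE.
Qed.

Lemma bad_vertex_outer_le : outer_le P' bad_vertex ((1 - e) ^+ (N - #|U|)).
Proof.
exact: (outer_le_liminf (fun h => grid_event_outer_le h) bad_vertex_grid).
Qed.

End BadVertex.

(** * Failure and measurability of the covering event *)

Section GoodEvent.
Context {R : realType} {n N : nat}.
Hypothesis N0 : (0 < N)%N.
Implicit Types (v : 'I_N -> 'rV[R]_n) (x t : 'rV[R]_n) (A : set 'rV[R]_n).

(** If the form were strictly smaller at every v_i and -v_i, averaging would preserve the strict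
    inequality. *)
Lemma absconv_dotp_le v y t : absconv v y -> exists i, dotp y t <= `|dotp (v i) t|.
Proof.
move=> [m [a [u [a0 a1 vu yE]]]]; apply: contrapT => /forallNP lt.
have ut j : dotp (u j) t < dotp y t.
  have [[i _ <-]|[i _ <-]] := vu j; have /negP := lt i; rewrite -ltNge.
    by apply: le_lt_trans; exact: ler_norm.
  by rewrite dotpNl; apply: le_lt_trans; rewrite -normrN ler_norm.
have au0 j : true -> 0 <= a j * (dotp y t - dotp (u j) t).
  by move=> _; rewrite mulr_ge0// subr_ge0 ltW.
have /(psumr_eq0P au0) {}au0 : \sum_j a j * (dotp y t - dotp (u j) t) = 0.
  rewrite (eq_bigr (fun j => a j * dotp y t - dotp (a j *: u j) t)); last first.
    by move=> j _; rewrite mulrBr dotpZl.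
  by rewrite sumrB -mulr_suml a1 mul1r -dotp_suml -yE subrr.
suff : \sum_(j < m) a j = 0 by rewrite a1 => /eqP; rewrite oner_eq0.
rewrite big1// => j _; have /eqP := au0 j isT.
by rewrite mulf_eq0 subr_eq0 (gt_eqF (ut j)) orbF => /eqP.
Qed.

Definition polar_covered A v := [set 2^-1 *: x | x in polar A] `<=` absconv v.

Lemma not_polar_covered A v : ~ polar_covered A v ->
  exists x t, [/\ polar A x, 1 < dotp x t & forall i, `|dotp (v i) t| <= 2^-1].
Proof.
move=> /existsNP[_ /not_implyP[[x Ax <-]]].
move=> /(absconv_separation N0)[t0]; rewrite dotpZl => t0v.
pose i0 := Ordinal N0.
pose m := \big[Num.max/0]_i `|dotp (v i) t0|.
have m0 : 0 <= m by exact: bigmax_ge_id.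
have mt : m < 2^-1 * dotp x t0.
  by apply: bigmax_lt => [|i _]; [exact: le_lt_trans (normr_ge0 _) (t0v i0) | exact: t0v].
have s0 : 0 < dotp x t0 + 2 * m by lra.
(* Since 2m < <x,t0>, this scaling puts <x,t> = 2<x,t0>/(<x,t0> + 2m) above 1 and keeps |<v_i,t>| <=
   2m/(<x,t0> + 2m) <= 1/2. *)
exists x, ((2 / (dotp x t0 + 2 * m)) *: t0); split => //.
  by rewrite dotpZr mulrAC ltr_pdivlMr// mul1r; lra.
move=> i; rewrite dotpZr normrM ger0_norm; last by rewrite divr_ge0// ltW.
rewrite mulrAC ler_pdivrMr//; have : `|dotp (v i) t0| <= m by exact: le_bigmax.
by lra.
Qed.

Let grid_pt (q : nat * 'rV[int]_n) : 'rV[R]_n := \row_k ((q.2 0 k)%:~R / q.1.+1%:R).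

(** Countably many test vectors suffice because strict separation is an open condition on t.
    Choosing i uniformly in x makes each condition a closed one on a single point, which yields
    measurability. *)
Lemma polar_coveredP A v : polar_covered A v <->
  forall q, exists i, forall x, polar A x ->
    2^-1 * dotp x (grid_pt q) <= `|dotp (v i) (grid_pt q)|.
Proof.
split=> [cov q|cov _ [x Ax <-]].
  set t := grid_pt q; apply: contrapT => /forallNP noi.
  (* If each i fails at some x_i, the x_i with the largest <x_i,t> fails for all indices at once, so
     half of it lies outside the hull. *)
  have : forall i, exists x, polar A x /\ `|dotp (v i) t| < 2^-1 * dotp x t.
    move=> i; have /existsNP[x /not_implyP[Ax /negP]] := noi i.
    by rewrite -ltNge => lt; exists x.
  move=> /choice[x xP].
  have [i _ imax] := @arg_maxP _ _ _ (Ordinal N0) predT (fun i => dotp (x i) t) isT.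
  have [j] : exists j, dotp (2^-1 *: x i) t <= `|dotp (v j) t|.
    by apply: absconv_dotp_le; apply: cov; exists (x i) => //; have [] := xP i.
  have [_] := xP j; have := imax j isT; rewrite /= dotpZl; lra.
apply: contrapT => /(absconv_separation N0)[t0 t0v].
pose t h := grid_pt (h, \row_k Num.floor (h.+1%:R * t0 0 k)).
have tt0 k : t h 0 k @[h --> \oo] --> t0 0 k.
  rewrite (_ : (fun h => _) = fun h : nat =>
    (Num.floor (h.+1%:R * t0 0 k))%:~R / h.+1%:R); first exact: cvg_floor_grid.
  by apply/funext => h; rewrite !mxE.
have cst_cvg (y : 'rV[R]_n) k : y 0 k @[_ --> \oo] --> y 0 k by exact: cvg_cst.
have [h _ hv] : \forall h \near \oo, forall i,
    `|dotp (v i) (t h)| - dotp (2^-1 *: x) (t h) < 0.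
  apply: filter_forall => i.
  have : `|dotp (v i) (t h)| - dotp (2^-1 *: x) (t h) @[h --> \oo] -->
      `|dotp (v i) t0| - dotp (2^-1 *: x) t0.
    by apply: cvgB; [apply: cvg_norm|]; exact: cvg_dotp.
  by move=> /cvgr_lt; apply; rewrite subr_lt0.
have [i /(_ x Ax)] := cov (h, \row_k Num.floor (h.+1%:R * t0 0 k)).
by have := hv h (leqnn h) i; rewrite dotpZl -/(t h); lra.
Qed.

Lemma bigcap_countType_measurable (d : measure_display) (T : measurableType d)
    (Z : countType) (F : Z -> set T) :
  (forall z, measurable (F z)) -> measurable (\bigcap_z F z).
Proof.
move=> mF; rewrite (_ : \bigcap_z _ =
    \bigcap_k (if pickle_inv k is Some z then F z else setT)).
  by apply: bigcapT_measurable => k; case: pickle_inv.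
apply/seteqP; split => w Fw z _; first by case: pickle_inv => // z'; exact: Fw.
by have := Fw (pickle z) I; rewrite pickleK_inv.
Qed.

Lemma polar_covered_measurable (d : measure_display) (T : measurableType d)
    (Xs : 'I_N -> T -> 'rV[R]_n) A : (forall i, random_vector (Xs i)) ->
  measurable [set w | polar_covered A (fun i => Xs i w)].
Proof.
move=> mXs; pose G q := [set y | forall x, polar A x ->
  2^-1 * dotp x (grid_pt q) <= `|dotp y (grid_pt q)|].
rewrite (_ : mkset _ = \bigcap_q \bigcup_(i in [set: 'I_N]) (Xs i @^-1` G q)).
  apply: bigcap_countType_measurable => q; apply: fin_bigcup_measurable => // i _.
  apply: mXs; apply: borel_closed.
  have cq : continuous (fun y => `|dotp y (grid_pt q)|).
    by move=> y; exact: (cvg_norm (@dotp_continuousl _ _ (grid_pt q) y)).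
  rewrite (_ : G q = \bigcap_(x in polar A) ((fun y => `|dotp y (grid_pt q)|) @^-1`
      [set r | 2^-1 * dotp x (grid_pt q) <= r]))//.
  apply: closed_bigI => x _; apply: closed_comp => [y _|]; last exact: closed_ge.
  exact: cq.
apply/seteqP; split => w.
  by move=> /polar_coveredP Gw q _; have [i Gi] := Gw q; exists i.
by move=> Gw; apply/polar_coveredP => q; have [i _ Gi] := Gw q I; exists i.
Qed.

End GoodEvent.

(** * Union bound over the vertices *)

Section Coverage.
Context {R : realType} {n N : nat} {d d' : measure_display}.
Context {T : measurableType d} {T' : measurableType d'}.
Variables (P : probability T R) (X : T -> 'rV[R]_n).
Variables (P' : probability T' R) (Xs : 'I_N -> T' -> 'rV[R]_n).
Hypotheses (mX : random_vector X) (copies : independent_copies P X P' Xs).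
Hypothesis N0 : (0 < N)%N.
Variable p : R.
Hypothesis p0 : 0 <= p.

Let K := floating_body P X p.

(** The cube must contain the separating t, so its size depends on w. Hence the conclusion for all
    large M, the form that [outer_le_liminf] takes. *)
Lemma not_covered_bad_vertex w : ~ polar_covered K (fun i => Xs i w) ->
  exists M0, forall M : nat, (M0 <= M)%N ->
    (\bigcup_(J in [set` [set J : {set bool * ('I_N + 'I_n)} | #|J| == n]%SET])
      bad_vertex P X Xs (expR (- p)) M%:R J) w.
Proof.
move=> /(not_polar_covered N0)[x [t [Kx xt tv]]].
exists (Num.bound (\sum_k `|t 0 k|)) => M M0M.
have tM k : `|t 0 k| <= M%:R.
  rewrite (@le_trans _ _ (\sum_k `|t 0 k|))//.
    by rewrite (bigD1 k)//= lerDl sumr_ge0.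
  apply: ltW; apply: lt_le_trans (archi_boundP _) _; first by rewrite sumr_ge0.
  by rewrite ler_nat.
have [|J [Jn J0 Jb xJ]] := @exists_vertex R n _ (constr (fun i => Xs i w))
    (bnd M%:R) x (@constr_bounded _ _ _ _) t.
  move=> [b [i|k]]; rewrite /constr /bnd/=; [have := tv i | have := tM k].
    by rewrite ler_norml => /andP[? ?]; case: b; rewrite ?dotpNl//; lra.
  by rewrite ler_norml => /andP[? ?]; case: b; rewrite ?dotpNl dotp_delta//; lra.
exists J; first by rewrite /= inE Jn.
split => //; last by move=> i; exact: (Jb (true, inl i)).
(* A vertex v in K would satisfy <x,v> <= 1, against <x,v> >= <x,t> > 1. *)
rewrite ltNge; apply/negP => KJ; have := Kx _ KJ.
by rewrite dotpC leNgt (lt_le_trans xt xJ).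
Qed.

(** J ranges over the n-element subsets of the 2(N + n) one-sided constraints, and each J involves
    at most n sample points. *)
Lemma not_covered_outer_le :
  outer_le P' (~` [set w | polar_covered K (fun i => Xs i w)])
    ('C(2 * (N + n), n)%:R * (1 - expR (- p)) ^+ (N - n)).
Proof.
have e01 : 0 <= expR (- p) <= 1 by rewrite expR_ge0 -expR0 ler_expR oppr_le0.
apply: (@outer_le_liminf _ _ _ _ _ (fun M : nat =>
    \bigcup_(J in [set` [set J : {set bool * ('I_N + 'I_n)} | #|J| == n]%SET])
      bad_vertex P X Xs (expR (- p)) M%:R J)); last exact: not_covered_bad_vertex.
move=> M.
have -> : 'C(2 * (N + n), n) = #|[set J : {set bool * ('I_N + 'I_n)} | #|J| == n]%SET|.
  by rewrite card_draws card_prod card_bool card_sum !card_ord.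
apply: outer_le_bigcup => J; rewrite inE => /eqP Jn.
apply: outer_leW (bad_vertex_outer_le mX copies e01 M%:R J) => //.
apply: ler_wiXn2l; rewrite ?subr_ge0 ?lerBlDr ?lerDl; [by case/andP: e01..|].
by apply: leq_sub2l; rewrite -[X in (_ <= X)%N]Jn; exact: card_points_of.
Qed.

Lemma covered_probability_ge (c : R) :
  'C(2 * (N + n), n)%:R * (1 - expR (- p)) ^+ (N - n) <= c ->
  ((1 - c)%:E <= P' [set w | polar_covered K (fun i => Xs i w)])%E.
Proof.
move=> Cc; have [mXs _ _] := copies.
have mG := @polar_covered_measurable R n N N0 _ _ Xs K mXs.
have [B [mB GB PB]] := not_covered_outer_le.
have PGc : (P' (~` [set w | polar_covered K (fun i => Xs i w)]) <= c%:E)%E.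
  rewrite (@le_trans _ _ (P' B))//.
    by apply: le_measure; rewrite ?inE//; exact: measurableC.
  by rewrite (le_trans PB)// lee_fin.
rewrite -[X in P' X]setCK probability_setC; last exact: measurableC.
by rewrite EFinB leeB.
Qed.

End Coverage.

(** * Binomial and exponential estimates *)

Section Numeric.
Context {R : realType}.
Implicit Types (n N m : nat).

(** n^n/n! is one term of the exponential series at n. *)
Lemma expn_le_expR_fact n : (0 < n)%N -> n%:R ^+ n <= expR (n%:R : R) * n`!%:R.
Proof.
case: n => // n _; rewrite -ler_pdivrMr ?ltr0n ?fact_gt0//.
by apply: le_trans (expR_ge1Dxn n (ler0n R n.+1)); rewrite lerDr.
Qed.

Lemma leq_ffact_exp m n : (m ^_ n <= m ^ n)%N.
Proof.
rewrite ffact_prod -[X in (_ <= _ ^ X)%N]card_ord -prod_nat_const.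
by apply: leq_prod => i _; exact: leq_subr.
Qed.

Lemma bin_le_expR m n : (0 < n)%N ->
  'C(m, n)%:R <= (m%:R / n%:R) ^+ n * expR n%:R :> R.
Proof.
move=> n0; have f0 : 0 < n`!%:R :> R by rewrite ltr0n fact_gt0.
rewrite -(ler_pM2r f0) -natrM bin_ffact -mulrA.
apply: le_trans (_ : (m%:R / n%:R) ^+ n * n%:R ^+ n <= _).
  by rewrite -exprMn divfK ?pnatr_eq0 -?lt0n// -natrX ler_nat leq_ffact_exp.
by apply: ler_wpM2l; [rewrite exprn_ge0// divr_ge0 | exact: expn_le_expR_fact].
Qed.

(** By exp(x) >= x^2/2, k exp(bL) >= (k b^2 L) L/2 >= 6L >= 5 + L, as k b^2 L >= 12 and L >= 1. *)
Lemma affine_le_expR (k b L : R) : 0 < k -> 0 < b ->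
  1 + 12 / (k * b ^+ 2) <= L -> 5 + L <= k * expR (b * L).
Proof.
move=> k0 b0 LL; have kb0 : 0 < k * b ^+ 2 by rewrite mulr_gt0// exprn_gt0.
have c0 : 0 < 12 / (k * b ^+ 2) by rewrite divr_gt0.
have L1 : 1 <= L by lra.
have : 12 <= k * b ^+ 2 * L by rewrite mulrC -ler_pdivrMr//; lra.
have : (b * L) ^+ 2 / 2 <= expR (b * L).
  have := @expR_ge1Dxn _ (b * L) 1; rewrite (_ : 2`! = 2%N)//.
  by move=> /(_ (mulr_ge0 (ltW b0) _)); move=> /(_ (le_trans ler01 L1)); lra.
move=> /(ler_wpM2l (ltW k0)) h1 h2; apply: le_trans h1.
rewrite [leRHS](_ : _ = k * b ^+ 2 * L * L / 2); last by ring.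
by have := ler_wpM2r (le_trans ler01 L1) h2; lra.
Qed.

(** With y = N/n, L = ln y and k = exp(-1)/4, the binomial is at most exp(n(5 + L)) and the power at
    most exp(-2k n y^(1-alpha)). For large L the former costs at most half of the latter exponent,
    and n y^(1-alpha) = N^(1-alpha) n^alpha. *)
Lemma bin_exp_bound (alpha : R) : 0 < alpha < 1 ->
  exists2 c0 : R, 0 < c0 & forall n N : nat, (0 < n)%N -> c0 * n%:R <= N%:R ->
  [/\ (0 < N)%N, 0 <= alpha * ln (expR 1 * N%:R / n%:R) &
  'C(2 * (N + n), n)%:R *
    (1 - expR (- (alpha * ln (expR 1 * N%:R / n%:R)))) ^+ (N - n) <=
  2 * expR (- (expR (-1) / 4 * N%:R `^ (1 - alpha) * n%:R `^ alpha)) ].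
Proof.
move=> /andP[a0 a1]; pose k : R := expR (-1) / 4; pose b := 1 - alpha.
have k0 : 0 < k by rewrite divr_gt0// expR_gt0.
have b0 : 0 < b by rewrite subr_gt0.
pose L0 := 1 + 12 / (k * b ^+ 2).
have L01 : 1 <= L0 by rewrite lerDl divr_ge0// mulr_ge0 ?exprn_ge0// ltW.
(* With this c0 the hypothesis on N reads ln(N/n) >= L0, the threshold of [affine_le_expR]. *)
exists (expR L0); first exact: expR_gt0.
move=> n N n0 cN; have nR0 : 0 < n%:R :> R by rewrite ltr0n.
have NR0 : 0 < N%:R :> R by rewrite (lt_le_trans _ cN)// mulr_gt0 ?expR_gt0.
pose y : R := N%:R / n%:R; have y0 : 0 < y by rewrite divr_gt0.
pose L := ln y.
have LL : L0 <= L by rewrite -[L0]expRK ler_ln ?posrE ?expR_gt0// ler_pdivlMr.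
have y2 : 2 <= y.
  rewrite -[y]lnK ?posrE//; have := expR_ge1Dx (ln y); rewrite -/L; lra.
have Nn : 2 * n%:R <= N%:R :> R by move: y2; rewrite ler_pdivlMr.
have nN : (n <= N)%N by rewrite -(ler_nat R); lra.
have lnE : ln (expR 1 * N%:R / n%:R) = 1 + L.
  by rewrite -mulrA lnM ?posrE ?expR_gt0// expRK.
rewrite lnE; set p := alpha * (1 + L).
have p0 : 0 <= p by rewrite mulr_ge0 ?(ltW a0)//; lra.
(* Bounding exp(-alpha) below by exp(-1) keeps the constant k independent of alpha. *)
have pe : expR (-1 - alpha * L) <= expR (- p).
  by rewrite ler_expR /p mulrDr mulr1; lra.
split => //; first by rewrite -(ltr_nat R).
have wE : N%:R `^ (1 - alpha) * n%:R `^ alpha = N%:R * expR (- (alpha * L)).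
  rewrite /powR !gt_eqF// -[X in _ = X * _](@lnK R) ?posrE// -!expRD; congr expR.
  by rewrite /L lnM ?posrE ?invr_gt0// lnV ?posrE//; ring.
have wE' : N%:R * expR (- (alpha * L)) = n%:R * expR (b * L).
  rewrite /b mulrBl mul1r expRD lnK ?posrE// mulrA; congr (_ * _).
  by rewrite /y mulrC divfK ?gt_eqF.
have h1 : 'C(2 * (N + n), n)%:R <= expR (n%:R * (5 + L)).
  apply: le_trans (bin_le_expR _ n0) _.
  have -> : expR n%:R = expR 1 ^+ n :> R by rewrite -expRM_natl mulr1.
  rewrite -exprMn expRM_natl.
  rewrite lerXn2r ?nnegrE ?expR_ge0 ?mulr_ge0 ?expR_ge0 ?divr_ge0//.
  (* The 1 is the factor e of [bin_le_expR]; the 4 comes from 2(N + n)/n <= 4y <= exp(4) y. *)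
  rewrite (_ : 5 + L = 4 + L + 1); last by ring.
  rewrite expRD ler_wpM2r ?expR_ge0// expRD lnK ?posrE//.
  apply: (@le_trans _ _ (4 * y)); last first.
    by rewrite ler_wpM2r ?(ltW y0)//; have := expR_ge1Dx (4 : R); lra.
  rewrite /y mulrA ler_wpM2r ?invr_ge0// natrM natrD; lra.
have h2 : (1 - expR (- p)) ^+ (N - n) <= expR (- (2 * k * n%:R * expR (b * L))).
  have e1 : expR (- p) <= 1 by rewrite -expR0 ler_expR oppr_le0.
  apply: (@le_trans _ _ (expR (- expR (- p)) ^+ (N - n))).
    rewrite lerXn2r ?nnegrE ?expR_ge0 ?subr_ge0//.
    by have := expR_ge1Dx (- expR (- p)); lra.
  rewrite -expRM_natl ler_expR mulrN lerN2.
  rewrite -!mulrA -wE' natrB//.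
  (* N >= 2n gives N - n >= N/2, hence the factor 2k = exp(-1)/2. *)
  apply: (@le_trans _ _ ((N%:R - n%:R) * expR (-1 - alpha * L))); last first.
    by rewrite ler_wpM2l// subr_ge0 ler_nat.
  rewrite expRD /k; set z := expR (-1); set u := expR (- _).
  have zu : 0 <= z * u by rewrite mulr_ge0 ?expR_ge0.
  rewrite [leLHS](_ : _ = N%:R / 2 * (z * u)); last by field.
  by rewrite ler_wpM2r//; lra.
apply: (@le_trans _ _ (expR (n%:R * (5 + L)) * expR (- (2 * k * n%:R * expR (b * L))))).
  by apply: ler_pM => //; rewrite exprn_ge0// subr_ge0 -expR0 ler_expR oppr_le0.
rewrite -expRD -[_ * _ * n%:R `^ alpha]mulrA wE wE' -/k.
apply: (@le_trans _ _ (expR (- (k * (n%:R * expR (b * L)))))); last first.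
  by have := expR_ge0 (- (k * (n%:R * expR (b * L)))); lra.
rewrite ler_expR; have := ler_wpM2l (ltW nR0) (affine_le_expR k0 b0 LL); lra.
Qed.
End Numeric.

(** * Choice of the constants and assembly of the estimates *)

Theorem theorem1p6 (R : realType) :
  exists2 c1 : R, 0 < c1 &
  forall alpha delta r rho : R,
    0 < alpha < 1 -> 0 < delta -> 0 < r -> 0 < rho ->
  exists2 c0 : R, 0 < c0 &
  forall (n : nat) (d : measure_display) (T : measurableType d)
    (P : probability T R) (X : T -> 'rV[R]_n) (nrm : 'rV[R]_n -> R)
    (gamma L : R),
    (0 < n)%N ->
    random_vector X -> symmetric_vector P X -> is_norm nrm ->
    0 < gamma -> 0 < L -> L / gamma = rho ->
    (forall t : 'rV[R]_n,
       (delta%:E <= P [set w | (gamma * nrm t <= `|dotp (X w) t|)%R])%E) ->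
    (forall t : 'rV[R]_n,
       (poweR (\int[P]_w ((`|dotp (X w) t| `^ r)%R)%:E) r^-1
          <= (L * nrm t)%:E)%E) ->
  forall (N : nat) (d' : measure_display) (T' : measurableType d')
    (P' : probability T' R) (Xs : 'I_N -> T' -> 'rV[R]_n),
    c0 * n%:R <= N%:R ->
    independent_copies P X P' Xs ->
    let p := alpha * ln (expR 1 * N%:R / n%:R) in
    ((1 - 2 * expR (- (c1 * (N%:R `^ (1 - alpha)) * (n%:R `^ alpha))))%:E
       <= P' [set w | [set (2^-1 : R) *: x | x in polar (floating_body P X p)]
                      `<=` absconv (fun i => Xs i w)])%E.
Proof.
exists (expR (-1) / 4); first by rewrite divr_gt0 ?expR_gt0.
move=> alpha delta r rho a01 _ _ _.
have [c0 c00 c0P] := bin_exp_bound a01; exists c0 => //.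
move=> n d T P X nrm gamma L n0 mX _ _ _ _ _ _ _ N d' T' P' Xs cN copies.
have [N0 p0 bound] := c0P n N n0 cN.
exact: (covered_probability_ge mX copies N0 p0 bound).
Qed.
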